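(* Let $n\ge 1$ be an integer and let $q\in\mathbb{C}$ be such that $q^j\neq 1$ for all $j=1,2,\dots,n-1$. Then the $n\times n$ Vandermonde matrix $V_q=\{q^{ij}\}_{0\le i,j\le n-1}$ satisfies $$V_q = L D L^T,$$ where $L=P_q T_q (P_q)^{-1}$ and $D$ is the $n\times n$ diagonal matrix having coefficients $\{(-1)^i q^{i(i-1)/2}(q;q)_i\}_{0\le i\le n-1}$ on the main diagonal.
   Context: All matrices are $n\times n$ with complex entries, with rows and columns indexed by $0,1,\dots,n-1$; $L^T$ denotes the (ordinary, non-conjugate) transpose. The $q$-Pochhammer symbol is $(z;q)_0:=1$ and $(z;q)_k:=(1-z)(1-zq)\cdots(1-zq^{k-1})$ for $k\ge 1$; in particular $(q;q)_k=(1-q)(1-q^2)\cdots(1-q^k)$. The convention $0^0=1$ is used. $T_q=\{t_{i,j}\}_{0\le i,j\le n-1}$ is the lower-triangular Toeplitz matrix with $t_{i,j}=1/(q;q)_{i-j}$ if $i\ge j$ and $t_{i,j}=0$ if $i<j$. $P_q$ is the diagonal matrix with entries $\{(q;q)_i\}_{0\le i\le n-1}$ on the main diagonal. The hypothesis on $q$ guarantees $(q;q)_k\ne 0$ for $0\le k\le n-1$, so $T_q$ and $(P_q)^{-1}$ are well-defined. *)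

(* Defs.v *)
From HB Require Import structures.
From mathcomp Require Import all_boot all_order all_algebra.

Set Implicit Arguments.
Unset Strict Implicit.
Unset Printing Implicit Defensive.

Import GRing.Theory.
Local Open Scope ring_scope.

Definition qpoch (F : fieldType) (z q : F) (k : nat) : F :=
  \prod_(0 <= j < k) (1 - z * q ^+ j).

Definition qVandermonde (F : fieldType) (n : nat) (q : F) : 'M[F]_n :=
  \matrix_(i < n, j < n) q ^+ (i * j).

Definition qToeplitz (F : fieldType) (n : nat) (q : F) : 'M[F]_n :=
  \matrix_(i < n, j < n) (if (j <= i)%N then (qpoch q q (i - j))^-1 else 0).

Definition qPdiag (F : fieldType) (n : nat) (q : F) : 'M[F]_n :=
  diag_mx (\row_(i < n) qpoch q q i).

(* invmx is the genuine inverse only for an invertible matrix, that is, when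
   qpoch q q i != 0 for all i < n. *)
Definition qL (F : fieldType) (n : nat) (q : F) : 'M[F]_n :=
  qPdiag n q *m qToeplitz n q *m invmx (qPdiag n q).

Definition qD (F : fieldType) (n : nat) (q : F) : 'M[F]_n :=
  diag_mx (\row_(i < n)
    ((-1) ^+ i * q ^+ ((i * (i - 1)) %/ 2)%N * qpoch q q i)).

(* Main.v *)
Require Import Defs.
From mathcomp Require Import all_boot all_order all_algebra.
From mathcomp Require Import reals complex.
From mathcomp Require Import ring.

Import GRing.Theory.
Local Open Scope ring_scope.
Local Open Scope complex_scope.

(** The entries of [L] are the Gaussian binomial coefficients [i k]_q
    (lemma [qL_qbinom]), so the factorization is the entrywise identity
      q^(i j) = \sum_k [i k]_q * ((-1)^k q^(k(k-1)/2) (q;q)_k) * [j k]_q.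
    It is the specialization at x = q^j of Cauchy's expansion
      x^i = \sum_k [i k]_q (x - 1) (x - q) ... (x - q^(k-1)),
    lemma [qbinom_expansion], which follows by induction on i from the q-Pascal
    rule.  Indeed, pulling q^m out of each factor q^j - q^m turns the product
    at x = q^j into (-1)^k q^(k(k-1)/2) (1 - q^j) ... (1 - q^(j-k+1)), and the
    remaining factors are (q;q)_j / (q;q)_(j-k) = [j k]_q (q;q)_k
    (lemma [qfall_qpow_qbinom]).  For k > j both sides vanish, the left one
    because of the factor m = j.  No power of q is ever inverted, so q = 0 is
    not special. *)

(** Defined by the q-Pascal rule rather than as a quotient of q-factorials, so
    that the coefficients make sense, and satisfy Cauchy's expansion, also
    when q is a root of unity. *)
Fixpoint qbinom {F : fieldType} (q : F) (i k : nat) : F :=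
  match i, k with
  | _, 0 => 1
  | 0, _.+1 => 0
  | i'.+1, k'.+1 => qbinom q i' k' + q ^+ k'.+1 * qbinom q i' k'.+1
  end.

Definition qfall {F : fieldType} (q x : F) (k : nat) : F :=
  \prod_(0 <= m < k) (x - q ^+ m).

Section QBinomial.

Context {F : fieldType}.
Implicit Types (q x : F) (i j k m n : nat).

Lemma qbinom0 q i : qbinom q i 0 = 1.
Proof. by case: i. Qed.

Lemma qbinomS q i k :
  qbinom q i.+1 k.+1 = qbinom q i k + q ^+ k.+1 * qbinom q i k.+1.
Proof. by []. Qed.

Lemma qbinom_small q i k : (i < k)%N -> qbinom q i k = 0.
Proof.
elim: i k => [|i IHi] [|k] //= ltik.
by rewrite !IHi ?mulr0 ?addr0 // ltnW.
Qed.

Lemma qpochS q k : qpoch q q k.+1 = qpoch q q k * (1 - q ^+ k.+1).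
Proof. by rewrite /qpoch big_nat_recr //= -exprS. Qed.

Lemma qpoch0 q : qpoch q q 0 = 1.
Proof. by rewrite /qpoch big_geq. Qed.

Lemma qpoch_neq0 q k :
  (forall j, (1 <= j <= k)%N -> q ^+ j != 1) -> qpoch q q k != 0.
Proof.
elim: k => [|k IHk] hq; first by rewrite qpoch0 oner_neq0.
rewrite qpochS mulf_neq0 //.
  by apply: IHk => j /andP[j_gt0 lejk]; rewrite hq // j_gt0 leqW.
by rewrite subr_eq0 eq_sym hq /=.
Qed.

(** The q-Pascal rule becomes, after multiplication by the q-factorials, the
    identity 1 - q^(k+m+2) = (1 - q^(k+1)) + q^(k+1) (1 - q^(m+1)). *)
Lemma qbinom_qpoch q k m :
  qbinom q (k + m) k * (qpoch q q k * qpoch q q m) = qpoch q q (k + m).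
Proof.
have [s] := ubnP (k + m); elim: s => // s IHs in k m *.
case: k => [|k]; first by rewrite qbinom0 qpoch0 !mul1r.
rewrite addSn qbinomS [qpoch q q (k + m).+1]qpochS ltnS => lts.
have IHk := IHs k m lts.
case: m => [|m] in lts IHk *.
  move: IHk; rewrite !addn0 => IHk.
  by rewrite (qbinom_small q _ _ (ltnSn k)) -IHk !qpochS qpoch0; ring.
have IHm : qbinom q (k + m.+1) k.+1 * (qpoch q q k.+1 * qpoch q q m) =
           qpoch q q (k + m.+1).
  by rewrite -addSnnS IHs // addSnnS.
transitivity (qpoch q q (k + m.+1) * (1 - q ^+ k.+1) +
              q ^+ k.+1 * (qpoch q q (k + m.+1) * (1 - q ^+ m.+1))).
  by rewrite -{1}IHk -IHm !qpochS; ring.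
by rewrite -addSn exprD; ring.
Qed.

Lemma qfallS q x k : qfall q x k.+1 = qfall q x k * (x - q ^+ k).
Proof. by rewrite /qfall big_nat_recr. Qed.

Lemma qfall_qpow_small q j k : (j < k)%N -> qfall q (q ^+ j) k = 0.
Proof.
elim: k => // k IHk; rewrite ltnS leq_eqVlt qfallS => /predU1P[->|/IHk->].
  by rewrite subrr mulr0.
by rewrite mul0r.
Qed.

(** Cauchy's expansion of a monomial: multiplying by x sends [qfall q x k] to
    [qfall q x k.+1 + q ^+ k * qfall q x k], so the coefficients obey the
    q-Pascal rule.  Any [n] larger than [i] may bound the sum, which is what
    allows [i] to be a row index and [n] the size of the matrix. *)
Lemma qbinom_expansion q x i n :
  (i < n)%N -> x ^+ i = \sum_(k < n) qbinom q i k * qfall q x k.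
Proof.
elim: i n => [|i IHi] [|n] // lein.
  rewrite big_ord_recl big1 /= ?addr0 => [|k _]; last by rewrite mul0r.
  by rewrite /qfall big_geq // mulr1.
rewrite big_ord_recl /= exprSr.
under eq_bigr => k _ do rewrite /bump /= add1n mulrDl.
rewrite big_split /= addrCA.
have -> : 1 * qfall q x 0 +
          \sum_(k < n) q ^+ k.+1 * qbinom q i k.+1 * qfall q x k.+1 =
          \sum_(k < n) q ^+ k * qbinom q i k * qfall q x k.
  (* The added term k = n is zero because i < n. *)
  transitivity (\sum_(k < n.+1) q ^+ k * qbinom q i k * qfall q x k).
    by rewrite big_ord_recl /= qbinom0 mulr1.
  by rewrite big_ord_recr /= qbinom_small // mulr0 mul0r addr0.
rewrite -big_split (IHi n) // big_distrl /=.
by apply: eq_bigr => k _; rewrite qfallS; ring.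
Qed.

(** With j = k + m, the factors are q^j - q^l = - q^l (1 - q^(j-l)) for l < k:
    the exponents l add up to 'C(k, 2), and [qpoch q q m] supplies the factors
    of [qpoch q q j] that are not among the 1 - q^(j-l). *)
Lemma qfall_qpow q k m :
  qfall q (q ^+ (k + m)) k * qpoch q q m =
  (-1) ^+ k * q ^+ 'C(k, 2) * qpoch q q (k + m).
Proof.
elim: k m => [|k IHk] m; first by rewrite /qfall big_geq // !mul1r.
rewrite qfallS addSnnS binS bin1 [q ^+ ('C(k, 2) + k)]exprD exprS.
transitivity (- q ^+ k * (qfall q (q ^+ (k + m.+1)) k * qpoch q q m.+1)).
  by rewrite qpochS exprD; ring.
by rewrite IHk; ring.
Qed.

Lemma qfall_qpow_qbinom q j k :
    (forall i, (1 <= i <= j)%N -> q ^+ i != 1) ->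
  qfall q (q ^+ j) k = (-1) ^+ k * q ^+ 'C(k, 2) * qpoch q q k * qbinom q j k.
Proof.
move=> hq; have [ltjk | lekj] := ltnP j k.
  by rewrite qfall_qpow_small // qbinom_small // mulr0.
have nz : qpoch q q (j - k) != 0.
  apply: qpoch_neq0 => i /andP[i_gt0 lei].
  by rewrite hq // i_gt0 (leq_trans lei) ?leq_subr.
apply: (mulIf nz); have := qfall_qpow q k (j - k).
by rewrite -qbinom_qpoch subnKC // => ->; ring.
Qed.

(** Right multiplication by the invertible diagonal matrix P turns
    L = P T P^-1 into the entrywise relation
    [i k]_q (q;q)_k = (q;q)_i / (q;q)_(i-k), free of [invmx]. *)
Lemma qL_qbinom n q :
    (forall j, (1 <= j <= n - 1)%N -> q ^+ j != 1) ->
  qL n q = \matrix_(i < n, k < n) qbinom q i k.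
Proof.
move=> hq.
have nz k : (k < n)%N -> qpoch q q k != 0.
  move=> ltkn; apply: qpoch_neq0 => j /andP[j_gt0 lejk].
  by rewrite hq // j_gt0 subn1 -ltnS (ltn_predK ltkn) (leq_ltn_trans lejk).
have Pu : qPdiag n q \in unitmx.
  rewrite unitmxE det_diag unitfE.
  by apply/prodf_neq0 => i _; rewrite mxE nz.
apply: (canLR (mulmxK Pu)); apply/matrixP=> i k.
rewrite mul_diag_mx mul_mx_diag !mxE.
case: leqP => [leki | ltik]; last by rewrite qbinom_small // mul0r mulr0.
have nzik : qpoch q q (i - k) != 0 by apply/nz/(leq_ltn_trans (leq_subr _ _)).
apply: (mulIf nzik); rewrite mulfVK // -mulrA.
by have := qbinom_qpoch q k (i - k); rewrite subnKC.
Qed.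

Lemma qVandermonde_LDLT n q :
    (forall j, (1 <= j <= n - 1)%N -> q ^+ j != 1) ->
  qVandermonde n q = qL n q *m qD n q *m (qL n q)^T.
Proof.
move=> hq; rewrite qL_qbinom //; apply/matrixP=> i j.
rewrite mul_mx_diag !mxE mulnC exprM (qbinom_expansion q _ _ _ (ltn_ord i)).
apply: eq_bigr => k _; rewrite !mxE divn2 subn1 -bin2 -mulrA.
congr (_ * _); apply: qfall_qpow_qbinom => l /andP[l_gt0 lelj].
have ltln := leq_ltn_trans lelj (ltn_ord j).
by rewrite hq // l_gt0 subn1 -ltnS (ltn_predK ltln).
Qed.

End QBinomial.

Theorem theorem1 (R : realType) (n : nat) (q : R[i])
    (hn : (1 <= n)%N)
    (hq : forall j : nat, (1 <= j <= n - 1)%N -> q ^+ j != 1) :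
  qVandermonde n q = qL n q *m qD n q *m (qL n q)^T.
Proof. exact: qVandermonde_LDLT. Qed.
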